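(* Let $1\le m<n$, let $X_1,\dots,X_m,Y$ be Banach spaces over $\mathbb{K}$ and let $q_1,\dots,q_m$ be positive real numbers. If $$\mathcal{L}(X_1,\dots,X_m;Y)=\mathcal{L}_{as(1;q_1,\dots,q_m)}(X_1,\dots,X_m;Y),$$ then, for any Banach spaces $X_{m+1},\dots,X_n$, $$\mathcal{L}(X_1,\dots,X_n;Y)=\mathcal{L}_{as(1;q_1,\dots,q_m,1,\dots,1)}(X_1,\dots,X_n;Y),$$ where $1$ is repeated $n-m$ times after $q_m$.
   Context: The scalar field $\mathbb{K}$ is either $\mathbb{R}$ or $\mathbb{C}$. $\mathcal{L}(X_1,\dots,X_n;Y)$ is the Banach space of continuous $n$-linear mappings from $X_1\times\cdots\times X_n$ into $Y$ with the sup norm. For a finite sequence $(x_j)_{j=1}^k$ in a Banach space $X$ and $q>0$, $\|(x_j)_{j=1}^k\|_{w,q}=\sup_{\varphi\in B_{X'}}\left(\sum_{j=1}^k|\varphi(x_j)|^q\right)^{1/q}$, where $B_{X'}$ is the closed unit ball of the dual $X'$. A continuous $n$-linear mapping $A:X_1\times\cdots\times X_n\to Y$ is absolutely $(p;q_1,\dots,q_n)$-summing if there is a constant $L\ge 0$ such that $$\left(\sum_{j=1}^k\|A(x_1^{(j)},\dots,x_n^{(j)})\|^p\right)^{1/p}\le L\prod_{i=1}^n\|(x_i^{(j)})_{j=1}^k\|_{w,q_i}$$ for every $k\in\mathbb{N}$ and all $x_i^{(1)},\dots,x_i^{(k)}\in X_i$, $i=1,\dots,n$. The space of all such mappings is $\mathcal{L}_{as(p;q_1,\dots,q_n)}(X_1,\dots,X_n;Y)$.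 *)

(* Defs.v *)
From HB Require Import structures.
From mathcomp Require Import all_boot all_order all_algebra.
From mathcomp Require Import all_classical all_reals all_analysis.
From mathcomp Require Import complex.

Set Implicit Arguments.
Unset Strict Implicit.
Unset Printing Implicit Defensive.

Import Order.TTheory GRing.Theory Num.Theory.
Import numFieldNormedType.Exports.

Local Open Scope classical_set_scope.
Local Open Scope ring_scope.

Variant scalar_kind := RealScalars | ComplexScalars.

Definition scalar_field (R : realType) (s : scalar_kind) : numFieldType :=
  match s with
  | RealScalars => R
  | ComplexScalars => R[i]
  end.

Definition scalar_re (R : realType) (s : scalar_kind) : scalar_field R s -> R :=
  match s with
  | RealScalars => fun z : R => z
  | ComplexScalars => fun z : R[i] => complex.Re z
  end.

(* Norms on a normed module over K take values in K (in the nonnegative reals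
   of K); rnorm is the same norm as an element of R, so that real powers and
   suprema make sense. *)
Definition rnorm (R : realType) (s : scalar_kind)
    (V : normedModType (scalar_field R s)) (x : V) : R :=
  scalar_re `|x|.

(* The last condition says that the operator norm, i.e. the supremum of
   |phi x| over the closed unit ball of X, is at most 1. *)
Definition dual_ball (R : realType) (s : scalar_kind)
    (X : normedModType (scalar_field R s)) : set (X -> (scalar_field R s)^o) :=
  [set phi | [/\ linear phi, continuous phi &
    forall x : X, rnorm x <= 1 -> rnorm (phi x) <= 1]].

Definition weak_norm (R : realType) (s : scalar_kind)
    (X : normedModType (scalar_field R s)) (q : R) (k : nat) (x : 'I_k -> X) : R :=
  sup [set (\sum_(j < k) rnorm (phi (x j)) `^ q) `^ q^-1
      | phi in @dual_ball R s X].

(* Continuity is for the product topology on the dependent product. *)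
Definition continuous_multilinear (R : realType) (s : scalar_kind)
    (I : finType) (X : I -> completeNormedModType (scalar_field R s))
    (Y : completeNormedModType (scalar_field R s)) : set ((forall i, X i) -> Y) :=
  [set A | (forall (x : forall i, X i) (i : I),
              linear (fun v : X i => A (dfwith x i v)))
           /\ continuous (A : prod_topology X -> Y)].

Definition absolutely_summing (R : realType) (s : scalar_kind)
    (I : finType) (p : R) (q : I -> R)
    (X : I -> completeNormedModType (scalar_field R s))
    (Y : completeNormedModType (scalar_field R s)) : set ((forall i, X i) -> Y) :=
  [set A | continuous_multilinear A /\
    exists2 L : R, 0 <= L &
      forall (k : nat) (x : forall i, 'I_k -> X i),
        (\sum_(j < k) rnorm (A (fun i => x i j)) `^ p) `^ p^-1
        <= L * \prod_i weak_norm (q i) (x i)].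

(* The n-term family (a_0, ..., a_(m-1), b_0, ..., b_(n-m-1)). *)
Definition fam_cat (T : Type) (m n : nat) (le_mn : (m <= n)%N)
    (a : 'I_m -> T) (b : 'I_(n - m) -> T) (i : 'I_n) : T :=
  match fintype.split (cast_ord (esym (subnKC le_mn)) i) with
  | inl j => a j
  | inr j => b j
  end.

Arguments continuous_multilinear {R s I} X Y.
Arguments absolutely_summing {R s I} p q X Y.

(* Main.v *)
(* The weak 1-norm controls signed sums: by Hahn-Banach,
   |sum_j e_j z_j| <= ||(z_j)||_{w,1} for all signs e_j. Fix all but one of the
   extra variables, let z be the remaining one and write A(x^j, z) for the value
   of A. Since A(x^j, z_j) is the average over the signs of
   e_j A(x^j, sum_l e_l z_l), the sum of the |A(x^j, z_j)| is at most the
   average of sum_j |A(x^j, sum_l e_l z_l)|, and for each choice of signs this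
   is a summing estimate for the map with one variable less, A(., z) with
   z = sum_l e_l z_l. Its constant is bounded by C |z|, by uniform boundedness
   over z. The extra variables are released in this way one at a time, starting
   from the maps with all of them frozen, which are summing by hypothesis.

   The Hahn-Banach functional is a minimal element among the sublinear
   functionals below the norm, which is automatically additive; this also works
   over C, where phi x = f x - i f(i x) is recovered from its real part f. *)

Require Import Defs.
From mathcomp Require Import all_boot all_order all_algebra.
From mathcomp Require Import all_classical all_reals all_analysis.
From mathcomp Require Import complex ring lra.

Set Implicit Arguments.
Unset Strict Implicit.
Unset Printing Implicit Defensive.

Import Order.TTheory GRing.Theory Num.Theory.
Import numFieldNormedType.Exports.

Local Open Scope classical_set_scope.
Local Open Scope ring_scope.

(** * Real numbers as scalars and the real-valued norm *)

Definition real_scalar (R : realType) (s : scalar_kind) :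
    R -> scalar_field R s :=
  match s with
  | RealScalars => fun t : R => t
  | ComplexScalars => fun t : R => real_complex R t
  end.

Arguments real_scalar {R} s t.

Section real_scalars.
Context {R : realType} {s : scalar_kind}.
Local Notation rs := (@real_scalar R s).
Local Notation K := (scalar_field R s).

Lemma real_scalarD : {morph rs : a b / a + b}.
Proof. by case: s => a b //=; rewrite rmorphD. Qed.

Lemma real_scalarM : {morph rs : a b / a * b}.
Proof. by case: s => a b //=; rewrite rmorphM. Qed.

Lemma real_scalar0 : rs 0 = 0.
Proof. by case: s. Qed.

Lemma real_scalar1 : rs 1 = 1.
Proof. by case: s. Qed.

Lemma real_scalarN : {morph rs : a / - a}.
Proof. by case: s => a //=; rewrite rmorphN. Qed.

Lemma le_real_scalar a b : (rs a <= rs b) = (a <= b).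
Proof. by case: s => //=; exact: lecR. Qed.

Lemma lt_real_scalar a b : (rs a < rs b) = (a < b).
Proof. by case: s => //=; exact: ltcR. Qed.

Lemma norm_real_scalar a : `|rs a| = rs `|a|.
Proof.
by case: s => //=; rewrite normc_def /= expr0n /= addr0 sqrtr_sqr.
Qed.

Lemma scalar_reK a : scalar_re (rs a) = a.
Proof. by case: s. Qed.

Lemma ge0_real_scalar (z : K) : 0 <= z -> rs (scalar_re z) = z.
Proof. by case: s z => //= z z0; apply: RRe_real; exact: ger0_real. Qed.

(** Positive elements of [R[i]] are real, so the radii of balls, which are scalars, can be handled
    as real numbers. *)
Lemma pos_real_scalarP (e : K) : 0 < e -> exists2 d : R, 0 < d & rs d = e.
Proof.
move=> e0; exists (scalar_re e); last exact/ge0_real_scalar/ltW.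
by rewrite -lt_real_scalar real_scalar0 ge0_real_scalar // ltW.
Qed.

Context {V : normedModType K}.
Implicit Types x y : V.

Lemma rnormE x : rs (rnorm x) = `|x|.
Proof. exact: ge0_real_scalar. Qed.

Lemma rnorm_ge0 x : 0 <= rnorm x.
Proof. by rewrite -(le_real_scalar 0) rnormE real_scalar0. Qed.

Lemma ler_rnormD x y : rnorm (x + y) <= rnorm x + rnorm y.
Proof. by rewrite -le_real_scalar real_scalarD !rnormE ler_normD. Qed.

Lemma rnormZ (a : K) x : rs (rnorm (a *: x)) = `|a| * rs (rnorm x).
Proof. by rewrite !rnormE normrZ. Qed.

Lemma rnormZ_real (t : R) x : rnorm (rs t *: x) = `|t| * rnorm x.
Proof.
apply/eqP; rewrite -(inj_eq (can_inj scalar_reK)); apply/eqP.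
by rewrite rnormZ norm_real_scalar real_scalarM.
Qed.

Lemma rnorm0 : rnorm (0 : V) = 0.
Proof. by rewrite -[LHS]scalar_reK rnormE normr0 -real_scalar0 scalar_reK. Qed.

Lemma rnormN x : rnorm (- x) = rnorm x.
Proof. by rewrite -[LHS]scalar_reK rnormE normrN -rnormE scalar_reK. Qed.

Lemma ball_rnorm x y (r : R) :
  ball x (rs r) y = (rnorm (x - y) < r) :> Prop.
Proof. by rewrite -ball_normE /ball_ /= -rnormE lt_real_scalar. Qed.

End real_scalars.

(** * Sublinear functionals and the real Hahn-Banach theorem *)

Section sublinear.
Context {R : realType} {s : scalar_kind} {V : normedModType (scalar_field R s)}.
Local Notation rs := (@real_scalar R s).
Implicit Types (p q : V -> R) (x y : V) (t : R).

(** Homogeneity is an inequality because infima inherit it directly in this form; applying it to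
    [t^-1] as well gives equality. *)
Definition sublinear p :=
  (forall x y, p (x + y) <= p x + p y) /\
  (forall t x, 0 < t -> p (rs t *: x) <= t * p x).

Lemma sublinearZ p t x : sublinear p -> 0 < t -> p (rs t *: x) = t * p x.
Proof.
move=> [_ pZ] t0; apply/eqP; rewrite eq_le pZ //=.
have := pZ t^-1 (rs t *: x); rewrite invr_gt0 => /(_ t0).
rewrite scalerA -real_scalarM mulVf ?gt_eqF // real_scalar1 scale1r.
by rewrite mulrC ler_pdivlMr // mulrC.
Qed.

Lemma sublinear0 p : sublinear p -> p 0 = 0.
Proof.
move=> sp; have := sublinearZ 0 sp (ltr0n R 2).
by rewrite scaler0 => ?; lra.
Qed.

Lemma sublinearZ0 p t x : sublinear p -> 0 <= t -> p (rs t *: x) = t * p x.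
Proof.
move=> sp; rewrite le_eqVlt => /predU1P[<-|]; last exact: sublinearZ.
by rewrite real_scalar0 scale0r mul0r sublinear0.
Qed.

Lemma sublinear_lbound p x y : sublinear p -> p y - p (- x) <= p (x + y).
Proof.
by move=> [pD _]; have := pD (x + y) (- x); rewrite addrAC subrr add0r; lra.
Qed.

Lemma sublinear_rnorm : sublinear (@rnorm R s V).
Proof.
split=> [|t x t0]; first exact: ler_rnormD.
by rewrite rnormZ_real gtr0_norm.
Qed.

(** Domination by [N] keeps the infimum finite, since [p x >= - p (- x) >= - N (- x)]. For
    subadditivity, the smaller of two comparable members is used at both points. *)
Lemma inf_sublinear (F : set (V -> R)) (N : V -> R) : F !=set0 ->
  (forall p, F p -> sublinear p /\ forall x, p x <= N x) ->
  (forall p q, F p -> F q ->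
     (forall x, p x <= q x) \/ (forall x, q x <= p x)) ->
  sublinear (fun x => inf [set p x | p in F]) /\
  (forall p x, F p -> inf [set p x | p in F] <= p x).
Proof.
move=> [p0 Fp0] FN Ftot.
have Flb x : has_lbound [set p x | p in F].
  exists (- N (- x)) => _ [p /FN[sp pN] <-].
  have := sublinear_lbound x 0 sp; rewrite addr0 sublinear0 //.
  by have := pN (- x); lra.
have inf_le p x : F p -> inf [set p x | p in F] <= p x.
  by move=> Fp; apply: ge_inf => //; exists p.
split=> //; split=> [x y|t x t0].
  rewrite -lerBlDr; apply: lb_le_inf; first by exists (p0 x), p0.
  move=> _ [p Fp <-]; rewrite lerBlDl -lerBlDr.
  apply: lb_le_inf; first by exists (p0 y), p0.
  move=> _ [q Fq <-]; rewrite lerBlDr.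
  have [pq|qp] := Ftot _ _ Fp Fq.
    have := inf_le p (x + y) Fp; have [[pD _] _] := FN p Fp.
    by have := pD x y; have := pq y; lra.
  have := inf_le q (x + y) Fq; have [[qD _] _] := FN q Fq.
  by have := qD x y; have := qp x; lra.
rewrite -ler_pdivrMl //; apply: lb_le_inf; first by exists (p0 x), p0.
move=> _ [p Fp <-]; rewrite ler_pdivrMl //.
by apply: (le_trans (inf_le p _ Fp)); have [[_ ->]] := FN p Fp.
Qed.

Lemma minimal_sublinear p0 : sublinear p0 -> exists p, [/\ sublinear p,
  (forall x, p x <= p0 x) &
  forall q, sublinear q -> (forall x, q x <= p x) -> forall x, p x <= q x].
Proof.
move=> sp0; pose P p := sublinear p /\ forall x, p x <= p0 x.
pose T := {p | P p}.
(* The order is reversed, so that the maximal element given by Zorn's lemma is a minimal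
   functional. *)
pose below (p q : T) := `[< forall x, sval q x <= sval p x >].
have [||||[p [sp pp0]] pmin] := @Zorn T below.
- by move=> p; apply/asboolP.
- move=> r p q /asboolP rp /asboolP pq; apply/asboolP => x.
  exact: (le_trans (pq x) (rp x)).
- move=> [p Pp] [q Pq] /asboolP/= qp /asboolP/= pq.
  have pq' : p = q by apply/funext => x; apply/eqP; rewrite eq_le pq qp.
  by subst q; congr exist; exact: Prop_irrelevance.
- move=> A Atot; have [->|/set0P[a Aa]] := eqVneq A set0.
    by exists (exist P p0 (conj sp0 (fun x => lexx _))) => ?.
  have [|||sinf inf_le] := @inf_sublinear [set sval p | p in A] p0.
  + by exists (sval a), a.
  + by move=> _ [p _ <-]; exact: (svalP p).
  + move=> _ _ [p Ap <-] [q Aq <-].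
    by have [/asboolP|/asboolP] := Atot p q Ap Aq; [right|left].
  have infp0 x : inf [set p x | p in [set sval p | p in A]] <= p0 x.
    apply: (le_trans (inf_le (sval a) x _)); first by exists a.
    by have [_] := svalP a; exact.
  exists (exist P _ (conj sinf infp0)) => p Ap; apply/asboolP => x /=.
  by apply: inf_le; exists p.
exists p; split => // q sq qp x.
have Pq : P q by split=> // y; exact: le_trans (qp y) (pp0 y).
by have /(congr1 sval)/= <- := pmin (exist P q Pq) ltac:(exact/asboolP).
Qed.

(* Pushing a sublinear functional down in the direction of [- y]; applied with
   a minimal [p] this gives [p (- y) = - p y]. *)
Lemma sublinear_tilt p y : sublinear p ->
  exists q, [/\ sublinear q, (forall x, q x <= p x) & q (- y) <= - p y].
Proof.
(* Taking [t = 0] bounds the infimum by [p], and [t = 1] gives the value at [- y]. It is finite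
   because [g x t >= - p (- x)]. *)
move=> sp; pose g x t := p (x + rs t *: y) - t * p y.
pose q x := inf [set g x t | t in [set t | 0 <= t]].
have q_le x t : 0 <= t -> q x <= g x t.
  move=> t0; apply: ge_inf; last by exists t.
  exists (- p (- x)) => _ [u u0 <-].
  by have := sublinear_lbound x (rs u *: y) sp; rewrite sublinearZ0 // /g; lra.
have q_ge x a : (forall t, 0 <= t -> a <= g x t) -> a <= q x.
  move=> ag; apply: lb_le_inf; first by exists (g x 0); exists 0 => /=.
  by move=> _ [t t0 <-]; exact: ag.
exists q; split.
- split=> [x z|t x t0].
    rewrite -lerBlDr; apply/q_ge => t t0; rewrite lerBlDl -lerBlDr.
    apply/q_ge => u u0; rewrite lerBlDr.
    apply: (le_trans (q_le _ (t + u) _)); first exact: addr_ge0.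
    rewrite /g real_scalarD scalerDl addrACA.
    have [pD _] := sp; have := pD (x + rs t *: y) (z + rs u *: y); lra.
  rewrite -ler_pdivrMl //; apply/q_ge => u u0; rewrite ler_pdivrMl //.
  apply: (le_trans (q_le _ (t * u) _)); first by rewrite mulr_ge0 // ltW.
  by rewrite /g real_scalarM -scalerA -scalerDr sublinearZ // mulrBr mulrA.
- move=> x; apply: (le_trans (q_le _ 0 (lexx _))).
  by rewrite /g real_scalar0 scale0r addr0 mul0r subr0.
- apply: (le_trans (q_le _ 1 ler01)).
  by rewrite /g real_scalar1 scale1r addNr sublinear0 // mul1r sub0r.
Qed.

(** Tilting the norm at [v] before minimising forces [f (- v) <= - rnorm v]. Minimality of [f]
    against its own tilts makes it odd, and an odd sublinear functional is real-linear; hence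
    [f v >= rnorm v]. *)
Lemma exists_norming_real_functional (v : V) : exists f : V -> R,
  [/\ forall x y, f (x + y) = f x + f y,
      forall t x, f (rs t *: x) = t * f x,
      forall x, f x <= rnorm x & rnorm v <= f v].
Proof.
have [p0 [sp0 p0N p0v]] := sublinear_tilt v sublinear_rnorm.
have [f [sf fp0 fmin]] := minimal_sublinear sp0.
have fN x : f (- x) = - f x.
  have [q [sq qf qx]] := sublinear_tilt x sf.
  have := fmin q sq qf (- x); have := sublinear_lbound x 0 sf.
  by rewrite addr0 sublinear0 // => ? ?; apply/eqP; rewrite eq_le; lra.
exists f; split.
- move=> x y; have := sublinear_lbound x y sf; rewrite fN.
  by have [fD _] := sf; have := fD x y => ? ?; apply/eqP; rewrite eq_le; lra.
- move=> t x; have [t0|t0] := leP 0 t; first exact: sublinearZ0.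
  rewrite -[rs t]opprK -real_scalarN scaleNr fN sublinearZ // ?oppr_gt0 //.
  by rewrite mulNr opprK.
- by move=> x; exact: le_trans (fp0 x) (p0N x).
- by have := fp0 (- v); rewrite fN; lra.
Qed.

End sublinear.

(** * Norming functionals *)

Lemma complexify_functional (R : realType) (V : normedModType R[i])
    (f : V -> R) :
  (forall x y, f (x + y) = f x + f y) ->
  (forall (t : R) x, f (t%:C%C *: x) = t * f x) ->
  (forall x, (f x)%:C%C <= `|x|) ->
  exists phi : V -> R[i]^o, [/\ linear phi, forall x, `|phi x| <= `|x| &
    forall x, complex.Re (phi x) = f x].
Proof.
move=> fD fZ fle.
pose phi x : R[i] := (f x)%:C%C - 'i%C * (f ('i%C *: x))%:C%C.
have ii : 'i%C * 'i%C = -1 :> R[i] by rewrite -expr2 sqr_i.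
have phiD x y : phi (x + y) = phi x + phi y.
  by rewrite /phi scalerDr !fD !rmorphD /=; ring.
have phiZr t x : phi (t%:C%C *: x) = t%:C%C * phi x.
  by rewrite /phi scalerA [_ * t%:C%C]mulrC -scalerA !fZ !rmorphM /=; ring.
have phiZi x : phi ('i%C *: x) = 'i%C * phi x.
  have -> : phi ('i%C *: x) = (f ('i%C *: x))%:C%C - 'i%C * (- f x)%:C%C.
    by rewrite /phi scalerA ii -(rmorphN1 (real_complex R)) fZ mulN1r.
  by rewrite /phi rmorphN /= mulrBr mulrA ii; ring.
have phiZ a x : phi (a *: x) = a * phi x.
  rewrite {1}[a]complexE scalerDl phiD phiZr -scalerA phiZi phiZr mulrA.
  by rewrite -mulrDl -complexE.
have RePhi x : complex.Re (phi x) = f x.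
  by rewrite /phi /= !(mul0r, mulr0, subr0, oppr0, addr0).
exists phi; split=> //; first by move=> a x y; rewrite phiD phiZ.
move=> x; have [->|c0] := eqVneq (phi x) 0; first by rewrite normr0.
(* Rotating [x] by the unimodular [u] makes the value of [phi] real and nonnegative; there it equals
   [f (u *: x)], and the one-sided bound on [f] applies. *)
pose u := `|phi x| / phi x.
have nu : `|u| = 1.
  by rewrite /u normrM normfV normr_id divff // normr_eq0.
have phiu : phi (u *: x) = `|phi x| by rewrite phiZ /u divfK.
by have := fle (u *: x); rewrite normrZ nu mul1r -RePhi phiu RRe_real.
Qed.

Section dual.
Context {R : realType} {s : scalar_kind}.
Local Notation K := (scalar_field R s).
Local Notation rs := (@real_scalar R s).

Lemma linear_contraction_continuous (V W : normedModType K) (f : V -> W) :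
  linear f -> (forall x, rnorm (f x) <= rnorm x) -> continuous f.
Proof.
move=> lf fle x; apply/cvg_ballP => e /pos_real_scalarP[d d0 <-].
near=> y; rewrite ball_rnorm.
have -> : f x - f y = f (x - y).
  by rewrite addrC -scaleN1r -lf scaleN1r addrC.
apply: le_lt_trans (fle _) _; rewrite -ball_rnorm.
by near: y; apply: nbhsx_ballx; rewrite -real_scalar0 lt_real_scalar.
Unshelve. all: end_near. Qed.

Lemma linear_ball_bound (V W : normedModType K) (f : V -> W) : linear f ->
  (forall x, rnorm x <= 1 -> rnorm (f x) <= 1) ->
  forall x, rnorm (f x) <= rnorm x.
Proof.
move=> lf f1 x; have f0 : f 0 = 0.
  by have := lf (-1) 0 0; rewrite scaler0 addr0 scaleN1r addNr.
have fZ t y : f (rs t *: y) = rs t *: f y.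
  by rewrite -[rs t *: y]addr0 lf f0 addr0.
have [x0|x0] := eqVneq (rnorm x) 0.
  have /eqP : rs (rnorm x) = 0 by rewrite x0 real_scalar0.
  by rewrite rnormE normr_eq0 => /eqP ->; rewrite f0 !rnorm0.
have xp : 0 < rnorm x by rewrite lt_neqAle eq_sym x0 rnorm_ge0.
have := f1 (rs (rnorm x)^-1 *: x); rewrite fZ !rnormZ_real.
rewrite ger0_norm ?invr_ge0 ?rnorm_ge0 // mulVf // => /(_ (lexx _)).
by rewrite mulrC ler_pdivrMr // mul1r.
Qed.

End dual.

Lemma exists_norming_functional (R : realType) (s : scalar_kind)
    (V : normedModType (scalar_field R s)) (v : V) :
  exists2 phi, dual_ball phi & rnorm v <= rnorm (phi v).
Proof.
have [f [fD fZ fle fv]] := exists_norming_real_functional v.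
suff [phi [lphi phile phiv]] : exists phi : V -> (scalar_field R s)^o,
    [/\ linear phi, forall x, rnorm (phi x) <= rnorm x &
        rnorm v <= rnorm (phi v)].
  exists phi => //; split => //.
    exact: linear_contraction_continuous.
  by move=> x; exact: le_trans.
have fN x : f (- x) = - f x.
  have f0 : f 0 = 0 by have := fD 0 0; rewrite addr0; lra.
  by have := fD x (- x); rewrite subrr f0; lra.
have absf x : `|f x| <= rnorm x.
  by rewrite ler_norml lerNl -fN -{1}(rnormN x) !fle.
case: s V v f fD fZ fle fv fN absf => V v f fD fZ fle fv fN absf.
  exists f; split.
  - by move=> a x y; rewrite fD fZ.
  - exact: absf.
  - exact: le_trans fv (ler_norm _).
have fle' x : (f x)%:C%C <= `|x|.
  by rewrite -[`|x|](@rnormE R ComplexScalars) /= lecR.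
have [phi [lphi phile phif]] := @complexify_functional R V f fD fZ fle'.
exists phi; split=> // [x|].
  by rewrite -(@le_real_scalar R ComplexScalars) !rnormE.
apply: le_trans fv _; apply: le_trans (ler_norm _) _.
rewrite -(@le_real_scalar R ComplexScalars) rnormE -phif.
exact: normc_ge_Re.
Qed.

(** * Signed sums and the weak 1-norm *)

Definition real_seminorm (R : realType) (s : scalar_kind)
    (V : normedModType (scalar_field R s)) (p : V -> R) :=
  (forall x y, p (x + y) <= p x + p y) /\
  (forall t x, p (real_scalar s t *: x) = `|t| * p x).

Section real_seminorm.
Context {R : realType} {s : scalar_kind} {V : normedModType (scalar_field R s)}.
Local Notation rs := (@real_scalar R s).
Implicit Types (p : V -> R) (x y : V).

Lemma real_seminormN p x : real_seminorm p -> p (- x) = p x.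
Proof.
move=> [_ pZ]; have := pZ (-1) x.
by rewrite real_scalarN real_scalar1 scaleN1r normrN1 mul1r.
Qed.

Lemma real_seminormB p x y : real_seminorm p -> p (x - y) <= p x + p y.
Proof. by move=> sp; rewrite -[p y]real_seminormN //; exact: (proj1 sp). Qed.

Lemma real_seminorm_linear (W : normedModType (scalar_field R s)) (f : V -> W) :
  linear f -> real_seminorm (fun x => rnorm (f x)).
Proof.
move=> lf; have f0 : f 0 = 0.
  by have := lf (-1) 0 0; rewrite scaler0 addr0 scaleN1r addNr.
split=> [x y|t x].
  by have := lf 1 x y; rewrite !scale1r => ->; exact: ler_rnormD.
by rewrite -[rs t *: x]addr0 lf f0 addr0 rnormZ_real.
Qed.

Lemma real_seminorm_sum k (p : 'I_k -> V -> R) :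
  (forall j, real_seminorm (p j)) -> real_seminorm (fun x => \sum_j p j x).
Proof.
move=> sp; split=> [x y|t x].
  by rewrite -big_split ler_sum // => j _; exact: (proj1 (sp j)).
by rewrite mulr_sumr; apply: eq_bigr => j _; exact: (proj2 (sp j)).
Qed.

(** Signs are coded by [bool], with [true] for -1, so that the sign patterns form a finite type to
    average over. *)
Definition signed_sum k (x : 'I_k -> V) (e : {ffun 'I_k -> bool}) : V :=
  \sum_(j < k) (-1) ^+ e j *: x j.

Lemma seminorm_signed_sum_le p k (x : 'I_k -> V) e : real_seminorm p ->
  p (signed_sum x e) <= \sum_j p (x j).
Proof.
move=> sp; rewrite /signed_sum; elim/big_rec2: _ => [|j a b _ ab].
  by have := proj2 sp 0 0; rewrite scaler0 normr0 mul0r => ->.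
apply: le_trans (proj1 sp _ _) _; apply: lerD => //.
by case: (e j); rewrite ?scaleN1r ?scale1r ?real_seminormN.
Qed.

(* Flipping the sign of the [j]-th summand changes the signed sum by
   [2 z_j] up to sign. *)
Lemma seminorm_signed_sum p k (z : 'I_k -> V) j : real_seminorm p ->
  #|{ffun 'I_k -> bool}|%:R * p (z j) <= \sum_e p (signed_sum z e).
Proof.
move=> sp; pose flip (e : {ffun 'I_k -> bool}) := [ffun i => e i (+) (i == j)].
have flipK : involutive flip.
  by move=> e; apply/ffunP => i; rewrite !ffunE -addbA addbb addbF.
have pflip e : 2 * p (z j) <= p (signed_sum z e) + p (signed_sum z (flip e)).
  apply: le_trans (real_seminormB _ _ sp).
  rewrite /signed_sum -sumrB (bigD1 j) //= big1 ?addr0 => [|i /negPf ij].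
    rewrite ffunE eqxx addbT -[2 in leLHS]gtr0_norm // -(proj2 sp).
    rewrite [rs _](_ : _ = 2); last by rewrite real_scalarD real_scalar1.
    by case: (e j); rewrite /= ?expr0 ?expr1 !(scaleN1r, scale1r) ?opprK
         -?opprD ?real_seminormN // scaler_nat mulr2n.
  by rewrite ffunE ij addbF subrr.
have : \sum_(e : {ffun 'I_k -> bool}) 2 * p (z j) <=
    \sum_e (p (signed_sum z e) + p (signed_sum z (flip e))).
  by rewrite ler_sum.
(* [flip] permutes the sign patterns, so the two halves of the right-hand sum agree and the factor 2
   cancels. *)
rewrite big_split /= -(reindex_inj (inv_inj flipK) (P := predT)
  (F := fun e => p (signed_sum z e))) /=.
rewrite sumr_const -mulr_natl; lra.
Qed.

(** Each [p j (z j)] is at most the average over [e] of [p j (signed_sum z e)]. After exchanging the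
    sums, all seminorms see the same vector for a given [e], and each [e] contributes at most
    [B]. *)
Lemma sum_seminorm_signed_sum k (p : 'I_k -> V -> R) (z : 'I_k -> V) (B : R) :
  (forall j, real_seminorm (p j)) ->
  (forall e, \sum_j p j (signed_sum z e) <= B) -> \sum_j p j (z j) <= B.
Proof.
move=> sp leB; pose N : R := #|{ffun 'I_k -> bool}|%:R.
have N0 : 0 < N.
  by rewrite ltr0n; apply/card_gt0P; exists [ffun=> true].
rewrite -(ler_pM2l N0) mulr_sumr.
apply: (@le_trans _ _ (\sum_j \sum_e p j (signed_sum z e))).
  by apply: ler_sum => j _; exact: seminorm_signed_sum.
rewrite exchange_big /=; apply: le_trans (ler_sum _ (fun e _ => leB e)) _.
by rewrite sumr_const -mulr_natl.
Qed.

End real_seminorm.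

Section weak_norm.
Context {R : realType} {s : scalar_kind} {X : normedModType (scalar_field R s)}.

Lemma sup_ge0 (E : set R) : (forall x, E x -> 0 <= x) -> 0 <= sup E.
Proof.
(* On a set without a supremum, [sup] takes the default value 0. *)
move=> E0; have [[[x Ex] ubE]|/sup_out ->//] := pselect (has_sup E).
exact: le_trans (E0 x Ex) (ub_le_sup ubE Ex).
Qed.

Lemma weak_norm_ge0 (q : R) k (x : 'I_k -> X) : 0 <= weak_norm q x.
Proof. by apply: sup_ge0 => _ [phi _ <-]; exact: powR_ge0. Qed.

Lemma sum_le_weak_norm1 k (x : 'I_k -> X) phi : dual_ball phi ->
  \sum_(j < k) rnorm (phi (x j)) <= weak_norm 1 x.
Proof.
move=> Bphi; have powE psi : (\sum_(j < k) rnorm (psi (x j)) `^ 1) `^ 1^-1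
    = \sum_(j < k) rnorm (psi (x j)) :> R.
  under eq_bigr do rewrite powRr1 ?rnorm_ge0 //.
  by rewrite invr1 powRr1 // sumr_ge0 // => j _; exact: rnorm_ge0.
rewrite /weak_norm; apply: ub_le_sup; last by exists phi; rewrite ?powE.
(* The sum of the norms bounds the set defining the weak norm, so its [sup] is a genuine upper
   bound. *)
exists (\sum_(j < k) rnorm (x j)) => _ [psi [lpsi _ psi1] <-].
by rewrite powE ler_sum // => j _; exact: linear_ball_bound.
Qed.

Lemma rnorm_signed_sum k (x : 'I_k -> X) e :
  rnorm (signed_sum x e) <= weak_norm 1 x.
Proof.
have [phi Bphi] := exists_norming_functional (signed_sum x e).
move=> /le_trans; apply; apply: le_trans (sum_le_weak_norm1 x Bphi).
have [lphi _ _] := Bphi.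
exact: (seminorm_signed_sum_le x e (real_seminorm_linear lphi)).
Qed.

End weak_norm.

(** * Uniform boundedness *)

Section uniform_boundedness.
Context {R : realType} {s : scalar_kind}.
Local Notation rs := (@real_scalar R s).

Lemma rnorm_continuous (V : normedModType (scalar_field R s)) :
  continuous (@rnorm R s V).
Proof.
move=> x; apply/cvg_ballP => e e0; near=> y.
rewrite -ball_normE /ball_ /= ltr_norml.
have xy : rnorm (x - y) < e.
  rewrite -ball_rnorm; near: y; apply: nbhsx_ballx.
  by rewrite -real_scalar0 lt_real_scalar.
have := ler_rnormD (x - y) y; have := ler_rnormD (- (x - y)) x.
by rewrite rnormN opprB !subrK => *; lra.
Unshelve. all: end_near. Qed.

Context {V : completeNormedModType (scalar_field R s)}.

(** The radii tend to 0, so the centres form a Cauchy sequence; the limit stays within [r n] of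
    [a n] because all later centres do. The radius [r 0] is left free for the starting ball. *)
Lemma closed_balls_cvg (a : nat -> V) (r : nat -> R) :
  (forall n, r n.+1 < n.+1%:R^-1) ->
  (forall m n, (n <= m)%N -> rnorm (a n - a m) <= r n) ->
  exists l, forall n, rnorm (a n - l) <= r n.
Proof.
move=> r_lt a_dist.
have a_cauchy : cauchy (a @ \oo).
  apply: cauchy_exP => e /pos_real_scalarP[d d0 <-].
  pose n := (Num.truncn d^-1).+1; exists (a n), n => // m /= nm.
  rewrite ball_rnorm; apply: le_lt_trans (a_dist _ _ nm) _.
  apply: lt_trans (r_lt _) _.
  by rewrite invf_plt ?posrE ?ltr0n // truncnS_gt.
have /cvg_ex[l al] : cvg (a @ \oo) by exact: cauchy_cvg.
exists l => n; apply/ler_addgt0Pr => d d0.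
have rd0 : 0 < rs d by rewrite -real_scalar0 lt_real_scalar.
have /cvg_ballP/(_ _ rd0)[M _ Ml] := al.
have := Ml (maxn M n) (leq_maxl _ _); rewrite /= ball_rnorm.
have := a_dist (maxn M n) n (leq_maxr _ _).
have := ler_rnormD (a n - a (maxn M n)) (a (maxn M n) - l).
rewrite -[rnorm (a _ - l)]rnormN opprB [X in rnorm X <= _](_ : _ = a n - l).
  by move=> *; lra.
by rewrite addrA subrK.
Qed.

(* The weights [w] make it unnecessary to divide by quantities that may
   vanish. *)
Lemma weighted_uniform_boundedness (T : Type) (p : T -> V -> R) (w : T -> R) :
  (forall i, real_seminorm (p i)) -> (forall i, continuous (p i)) ->
  (forall i, 0 <= w i) ->
  (forall x, exists L, forall i, p i x <= L * w i) ->
  exists2 C, 0 <= C & forall i x, p i x <= C * rnorm x * w i.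
Proof.
move=> sp cp w0 pw.
(* Baire dichotomy: either some ball carries a bound [N * w i], which is then rescaled, or no ball
   does, and nested balls shrink to a point violating [pw]. *)
have [[x0 [r [N [r0 N0 pN]]]]|nbounded] := pselect (exists x0 r N,
    [/\ 0 < r, 0 <= N & forall i y, rnorm (x0 - y) < r -> p i y <= N * w i]).
  exists (4 * N / r) => [|i x]; first by rewrite divr_ge0 ?mulr_ge0 // ltW.
  have p0 : p i 0 = 0 by have := proj2 (sp i) 0 0; rewrite scaler0 normr0 mul0r.
  have [x0'|x_neq0] := eqVneq (rnorm x) 0.
    have /eqP : rs (rnorm x) = 0 by rewrite x0' real_scalar0.
    rewrite rnormE normr_eq0 => /eqP ->.
    by rewrite rnorm0 p0 mulr0 mul0r.
  have xp : 0 < rnorm x by rewrite lt_neqAle eq_sym x_neq0 rnorm_ge0.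
  (* With this [t] the vector [rs t *: x] has norm [r / 2]. Writing it as a difference of two points
     of the ball costs [2 * N], and dividing by [t] gives the constant [4 * N / r]. *)
  pose t := r / (2 * rnorm x); have t0 : 0 < t by rewrite divr_gt0 ?mulr_gt0.
  have pt : p i (rs t *: x) <= 2 * (N * w i).
    have -> : rs t *: x = (x0 + rs t *: x) - x0.
      by rewrite addrC addrA addNr add0r.
    apply: le_trans (real_seminormB _ _ (sp i)) _.
    have h1 : p i x0 <= N * w i by apply: pN; rewrite subrr rnorm0.
    have h2 : p i (x0 + rs t *: x) <= N * w i.
      apply: pN; rewrite opprD addrA subrr sub0r rnormN rnormZ_real.
      rewrite gtr0_norm //.
      rewrite (_ : t * rnorm x = r / 2); first by lra.
      by rewrite /t; field; rewrite gt_eqF.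
    by lra.
  move: pt; rewrite (proj2 (sp i)) gtr0_norm // -ler_pdivlMl //.
  move=> /le_trans; apply; rewrite /t invf_div le_eqVlt; apply/orP; left.
  by apply/eqP; field; rewrite gt_eqF.
have step (nxr : nat * (V * {posnum R})) : exists yt : V * {posnum R},
    [/\ yt.2%:num < nxr.1.+1%:R^-1,
        forall z, rnorm (yt.1 - z) <= yt.2%:num ->
          rnorm (nxr.2.1 - z) <= nxr.2.2%:num &
        exists i, forall z, rnorm (yt.1 - z) <= yt.2%:num ->
          nxr.1%:R * w i < p i z].
  case: nxr => n [x r] /=.
  have [i [y [xy py]]] :
      exists i y, rnorm (x - y) < r%:num /\ n%:R * w i < p i y.
    apply: contrapT => h; apply: nbounded; exists x, r%:num, n%:R.
    split=> // i y xy; rewrite leNgt; apply/negP => py.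
    by apply: h; exists i, y.
  have /nbhs_ballP[e /= /pos_real_scalarP[d d0 <-] yd] :
      \forall z \near y, n%:R * w i < p i z.
    exact: cvgr_gt (cp i y) _ py.
  (* The three terms keep the closed ball inside the region where [p i] is large, keep it inside the
     previous ball, and make the radius strictly less than [n.+1%:R^-1]. *)
  pose t := Num.min (d / 2) (Num.min (r%:num - rnorm (x - y)) (n.+2%:R^-1)).
  have t0 : 0 < t by rewrite !lt_min divr_gt0 //= subr_gt0 xy invr_gt0 ltr0n.
  have : t <= t by []; rewrite {2}/t !le_min => /and3P[td tr tn].
  exists (y, PosNum t0); split=> /=.
  - by apply: le_lt_trans tn _; rewrite ltf_pV2 ?posrE ?ltr0n // ltr_nat.
  - move=> z yz; have := ler_rnormD (x - y) (y - z); rewrite addrA subrK.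
    by lra.
  - exists i => z yz; apply: yd; rewrite ball_rnorm.
    by apply: le_lt_trans yz _; lra.
have [f fP] := choice step.
pose fix ar n : V * {posnum R} :=
  if n is m.+1 then f (m, ar m) else (0, PosNum ltr01).
have nested m n z : (n <= m)%N -> rnorm ((ar m).1 - z) <= (ar m).2%:num ->
    rnorm ((ar n).1 - z) <= (ar n).2%:num.
  elim: m => [|m IH]; first by rewrite leqn0 => /eqP ->.
  rewrite leq_eqVlt => /predU1P[-> //|nm] mz; apply: IH => //.
  by have [_ + _] := fP (m, ar m); exact.
have [l al] : exists l, forall n, rnorm ((ar n).1 - l) <= (ar n).2%:num.
  apply: (@closed_balls_cvg (fun n => (ar n).1) (fun n => (ar n).2%:num)).
    by move=> n; have [] := fP (n, ar n).
  by move=> m n nm; apply: (nested m) => //; rewrite subrr rnorm0.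
(* The common point [l] lies in the ball built at stage [n > L], so some [p i l] exceeds
   [n%:R * w i], against the bound [L * w i]. *)
have [L pL] := pw l; pose n := (Num.truncn L).+1.
have [_ _ [i /(_ l (al n.+1))]] := fP (n, ar n).
rewrite ltNge => /negP[]; apply: le_trans (pL i) _.
by rewrite ler_wpM2r // ltW // truncnS_gt.
Qed.

End uniform_boundedness.

(** * Releasing the frozen coordinates *)

(** The powers with exponent 1 disappear, and a constant of any sign can be replaced by its absolute
    value because weak norms are nonnegative. *)
Lemma absolutely_summing1P (R : realType) (s : scalar_kind) (I : finType)
    (q : I -> R) (X : I -> completeNormedModType (scalar_field R s))
    (Y : completeNormedModType (scalar_field R s)) (A : (forall i, X i) -> Y) :
  absolutely_summing 1 q X Y A <->
  continuous_multilinear X Y A /\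
  exists L : R, forall k (x : forall i, 'I_k -> X i),
    \sum_(j < k) rnorm (A (fun i => x i j))
    <= L * \prod_i weak_norm (q i) (x i).
Proof.
have powE k (x : forall i, 'I_k -> X i) :
    (\sum_(j < k) rnorm (A (fun i => x i j)) `^ 1) `^ 1^-1
    = \sum_(j < k) rnorm (A (fun i => x i j)).
  under eq_bigr do rewrite powRr1 ?rnorm_ge0 //.
  by rewrite invr1 powRr1 // sumr_ge0 // => j _; exact: rnorm_ge0.
split=> -[hA].
  by move=> [L _ AL]; split=> //; exists L => k x; rewrite -powE.
move=> [L AL]; split=> //; exists `|L| => // k x; rewrite powE.
apply: le_trans (AL k x) _; apply: ler_wpM2r (ler_norm L).
by apply: prodr_ge0 => i _; exact: weak_norm_ge0.
Qed.

Section frozen_coordinates.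
Context {R : realType} {s : scalar_kind} {I : finType}.
Context {W : I -> completeNormedModType (scalar_field R s)}.
Context {Y : completeNormedModType (scalar_field R s)}.
Variables (q : I -> R) (A : (forall i, W i) -> Y).
Hypothesis hA : continuous_multilinear W Y A.
Implicit Types (P : {set I}) (z x : forall i, W i).

Definition freeze P z x : forall i, W i :=
  fun i => if i \in P then z i else x i.

Definition frozen_summing P := forall z, exists L : R,
  forall k (x : forall i, 'I_k -> W i),
    \sum_(j < k) rnorm (A (freeze P z (fun i => x i j)))
    <= L * \prod_(i | i \notin P) weak_norm (q i) (x i).

Lemma coordinate_seminorm x i :
  real_seminorm (fun v => rnorm (A (dfwith x i v))).
Proof. exact/real_seminorm_linear/(proj1 hA). Qed.

Lemma coordinate_continuous x i :
  continuous (fun v => rnorm (A (dfwith x i v))).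
Proof.
move=> v; apply: (@continuous_comp _ _ _
  (fun v => A (dfwith x i v)) (@rnorm R s Y)).
  apply: (@continuous_comp _ (prod_topology W) _ (dfwith x i) A).
    exact: dfwith_continuous.
  exact: (proj2 hA).
exact: rnorm_continuous.
Qed.

Lemma freeze_dfwith P z x i v : i \in P ->
  freeze P (dfwith z i v) x = dfwith (freeze P z x) i v.
Proof.
move=> iP; apply/functional_extensionality_dep => j.
case: (dfwithP (freeze P z x) v) => [|k ik]; rewrite /freeze.
  by rewrite iP dfwithin.
by rewrite dfwithout.
Qed.

Lemma freezeD1 P z x i : i \in P ->
  freeze (P :\ i) z x = dfwith (freeze P z x) i (x i).
Proof.
move=> iP; apply/functional_extensionality_dep => j.
case: (dfwithP (freeze P z x) (x i)) => [|k ik]; rewrite /freeze in_setD1.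
  by rewrite eqxx.
by rewrite eq_sym ik.
Qed.

Lemma unfreeze P i : i \in P -> q i = 1 ->
  frozen_summing P -> frozen_summing (P :\ i).
Proof.
move=> iP qi sumP z.
(* Uniform boundedness is applied to seminorms in the [i]-th variable, indexed by all finite
   families at once. The weight is the product of the weak norms of the variables outside [P], and
   the pointwise bound is the hypothesis with [i] frozen at [v]. *)
pose T := {k : nat & forall i, 'I_k -> W i}.
pose p (kx : T) (v : W i) := \sum_j
  rnorm (A (dfwith (freeze P z (fun i => tagged kx i j)) i v)).
pose w (kx : T) := \prod_(i | i \notin P) weak_norm (q i) (tagged kx i).
have [||||C C0 pC] := @weighted_uniform_boundedness R s (W i) T p w.
- by move=> kx; apply: real_seminorm_sum => j; exact: coordinate_seminorm.
- move=> kx; apply: continuous_big => [|j _].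
    exact: add_continuous.
  exact: coordinate_continuous.
- by move=> kx; apply: prodr_ge0 => l _; exact: weak_norm_ge0.
- move=> v; have [L AL] := sumP (dfwith z i v); exists L => -[k x].
  by rewrite /p; under eq_bigr do rewrite -freeze_dfwith //; exact: AL.
exists C => k x; under [leLHS]eq_bigr do rewrite freezeD1 //.
(* Sign averaging puts one vector, independent of [j], in coordinate [i]; its norm is at most the
   weak 1-norm of [x i], the new factor in the product. *)
apply: (@sum_seminorm_signed_sum _ _ _ _
  (fun j v => rnorm (A (dfwith (freeze P z (fun i => x i j)) i v)))).
  by move=> j; exact: coordinate_seminorm.
move=> e; apply: le_trans (pC (Tagged (fun k => forall i, 'I_k -> W i) x) _) _.
rewrite (bigD1 i) /=; last by rewrite in_setD1 eqxx.
rewrite qi mulrA; under eq_bigl => l do rewrite in_setD1 negb_and negbK.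
rewrite [X in _ <= _ * X](_ : _ = w (Tagged _ x)); last first.
  apply: eq_bigl => l; have [->|_] := eqVneq l i; last by rewrite andbT.
  by rewrite iP.
apply: ler_wpM2r; first by apply: prodr_ge0 => l _; exact: weak_norm_ge0.
by apply: ler_wpM2l => //; exact: rnorm_signed_sum.
Qed.

Lemma frozen_summing_set0 P : (forall i, i \in P -> q i = 1) ->
  frozen_summing P -> frozen_summing finset.set0.
Proof.
have [n] := ubnP #|P|; elim: n P => // n IH P leP q1 sumP.
have [P0|[i iP]] := set_0Vmem P; first by rewrite -P0.
apply: (IH (P :\ i)); last exact: unfreeze (q1 i iP) sumP.
  by move: leP; rewrite (cardsD1 i) iP.
by move=> j /setD1P[_]; exact: q1.
Qed.

Lemma absolutely_summing_frozen P : (forall i, i \in P -> q i = 1) ->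
  frozen_summing P -> absolutely_summing 1 q W Y A.
Proof.
move=> q1 sumP; apply/absolutely_summing1P; split=> //.
(* With the empty set frozen, every base point yields [A] itself; zero is one choice. *)
have [L AL] := frozen_summing_set0 q1 sumP (fun i => 0).
exists L => k x; have := AL k x.
rewrite [X in _ * X](eq_bigl xpredT) => [|i]; last by rewrite inE.
by apply: le_trans; rewrite le_eqVlt; apply/orP; left; apply/eqP;
  apply: eq_bigr => j _; congr (rnorm (A _));
  apply/functional_extensionality_dep => i; rewrite /freeze inE.
Qed.

End frozen_coordinates.

(** * Reindexing the variables *)

Lemma continuous_prod_topology (T : topologicalType) (I : eqType)
    (K : I -> topologicalType) (f : T -> prod_topology K) :
  (forall i, continuous (fun t => f t i)) -> continuous f.
Proof.
move=> cf t; apply/cvg_sup => i U [_ [[V Vopen <-]] /= Vft] sub.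
apply: filterS sub _; apply: cf; exact: open_nbhs_nbhs.
Qed.

Section sum_index.
Context {R : realType} {s : scalar_kind} {I J : finType}.
Variables (X : I -> completeNormedModType (scalar_field R s)).
Variables (Z : J -> completeNormedModType (scalar_field R s)).
Variables (Y : completeNormedModType (scalar_field R s)) (q : I -> R).

(** Indexing by [I + J] separates given from added variables without ordinal arithmetic; the passage
    to [fam_cat] is a reindexing. *)
Definition sum_family (T : Type) (a : I -> T) (b : J -> T) (o : I + J) : T :=
  match o with inl i => a i | inr j => b j end.

Local Notation W := (sum_family X Z).

Definition glue (x : forall i, X i) (z : forall o, W o) : forall o, W o :=
  fun o => match o return W o with inl i => x i | inr j => z (inr j) end.

Lemma glue_dfwith x z i v : glue (dfwith x i v) z = dfwith (glue x z) (inl i) v.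
Proof.
apply/functional_extensionality_dep => o.
case: (dfwithP (glue x z) (v : W (inl i))) => [/=|]; first by rewrite dfwithin.
by move=> [i'|j] //= ii'; rewrite dfwithout //; apply: contra_neq ii' => ->.
Qed.

Lemma glue_continuous z :
  continuous ((fun x => glue x z) : prod_topology X -> prod_topology W).
Proof.
apply: continuous_prod_topology => -[i|j] /=; last exact: cst_continuous.
exact: (@proj_continuous _ X i).
Qed.

Lemma continuous_multilinear_glue (A : (forall o, W o) -> Y) z :
  continuous_multilinear W Y A ->
  continuous_multilinear X Y (fun x => A (glue x z)).
Proof.
move=> [linA cA]; split.
  move=> x i; have := linA (glue x z) (inl i).
  by congr (linear _); apply/funext => v; rewrite glue_dfwith.
move=> x; apply: (@continuous_comp (prod_topology X) (prod_topology W) Y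
  (fun x => glue x z) A x).
  exact: glue_continuous.
exact: cA.
Qed.

Lemma absolutely_summing_sum :
  continuous_multilinear X Y `<=` absolutely_summing 1 q X Y ->
  continuous_multilinear W Y `<=`
  absolutely_summing 1 (sum_family q (fun=> 1)) W Y.
Proof.
move=> XY A hA.
(* All added coordinates start frozen; what remains is a continuous multilinear map on [X], summing
   by hypothesis. *)
pose P : {set I + J} := [set o | if o is inr _ then true else false]%SET.
apply: (@absolutely_summing_frozen _ _ _ _ _ _ _ hA P) => [[i|//]|].
  by rewrite inE.
move=> z.
have /XY/absolutely_summing1P[_ [L AL]] := continuous_multilinear_glue z hA.
exists L => k x; have := AL k (fun i => x (inl i)); rewrite big_sumType /=.
rewrite [X in _ <= _ * (_ * X)]big_pred0 => [|j]; last by rewrite inE.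
rewrite mulr1 [X in _ -> _ <= _ * X](eq_bigl xpredT) => [|i]; last first.
  by rewrite inE.
congr (_ <= _); apply: eq_bigr => j _; congr (rnorm (A _)).
by apply/functional_extensionality_dep => -[i|l]; rewrite /freeze inE.
Qed.

End sum_index.

(** The value [x (g o)] lives over [e (g o)] and is transported along [gK]. At [o = e i] this is
    transport along a proof of [e i = e i], trivial by uniqueness of equality proofs. *)
Lemma dep_fun_reindex (I O : eqType) (F : O -> Type) (e : I -> O) :
  bijective e -> forall x : (forall i, F (e i)),
  exists y : forall o, F o, forall i, y (e i) = x i.
Proof.
move=> [g eK gK] x; exists (fun o => eq_rect _ F (x (g o)) _ (gK o)) => i.
move: (gK (e i)); rewrite eK => ee.
by rewrite (eq_irrelevance ee erefl).
Qed.

Section reindex.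
Context {R : realType} {s : scalar_kind} {I O : finType}.
Variables (F : O -> completeNormedModType (scalar_field R s)).
Variables (Y : completeNormedModType (scalar_field R s)).
Variables (e : I -> O) (q : O -> R).
Hypothesis bij_e : bijective e.

Lemma dfwith_reindex (y : forall o, F o) i (v : F (e i)) :
  (fun i' => dfwith y (e i) v (e i')) =
  dfwith (fun i' => y (e i')) i v :> (forall i', F (e i')).
Proof.
apply/functional_extensionality_dep => i'.
case: (dfwithP (T := fun i' => F (e i')) (fun i' => y (e i')) v) => [|j ij].
  by rewrite dfwithin.
by rewrite dfwithout // (inj_eq (bij_inj bij_e)).
Qed.

Lemma continuous_multilinear_reindex (A : (forall i, F (e i)) -> Y) :
  continuous_multilinear (fun i => F (e i)) Y A ->
  continuous_multilinear F Y (fun y => A (fun i => y (e i))).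
Proof.
move=> [linA cA]; split.
  move=> y o; have [g _ gK] := bij_e; rewrite -(gK o).
  have := linA (fun i => y (e i)) (g o).
  by congr (linear _); apply/funext => v; rewrite dfwith_reindex.
move=> y; apply: (@continuous_comp (prod_topology F)
  (prod_topology (fun i => F (e i))) Y (fun y i => y (e i)) A y).
  by apply: continuous_prod_topology => i; exact: (@proj_continuous _ F (e i)).
exact: cA.
Qed.

Lemma absolutely_summing_reindex :
  continuous_multilinear F Y `<=` absolutely_summing 1 q F Y ->
  continuous_multilinear (fun i => F (e i)) Y `<=`
  absolutely_summing 1 (fun i => q (e i)) (fun i => F (e i)) Y.
Proof.
move=> FY A hA; apply/absolutely_summing1P; split=> //.
have /FY/absolutely_summing1P[_ [L AL]] := continuous_multilinear_reindex hA.
exists L => k x.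
have [y yx] := @dep_fun_reindex _ _ (fun o => 'I_k -> F o) _ bij_e x.
have -> : x = fun i => y (e i).
  by apply/functional_extensionality_dep => i; rewrite yx.
rewrite -(reindex e (onW_bij _ bij_e) (P := xpredT)
  (F := fun o => weak_norm (q o) (y o))).
exact: AL.
Qed.

End reindex.

Theorem corollary1 (R : realType) (s : scalar_kind) (m n : nat)
    (m_ge1 : (1 <= m)%N) (lt_mn : (m < n)%N)
    (X : 'I_m -> completeNormedModType (scalar_field R s))
    (Y : completeNormedModType (scalar_field R s))
    (q : 'I_m -> R) (q_gt0 : forall i, 0 < q i)
    (coincidence : continuous_multilinear X Y = absolutely_summing 1 q X Y)
    (Z : 'I_(n - m) -> completeNormedModType (scalar_field R s)) :
  let W := fam_cat (ltnW lt_mn) X Z in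
  continuous_multilinear W Y =
  absolutely_summing 1 (fam_cat (ltnW lt_mn) q (fun=> 1)) W Y.
Proof.
move=> W; apply/seteqP; split=> [|A []//].
pose eqmn := subnKC (ltnW lt_mn).
have bij_split :
    bijective (fun i : 'I_n => fintype.split (cast_ord (esym eqmn) i)).
  exists (fun o => cast_ord eqmn (unsplit o)) => [i|o].
    by rewrite splitK cast_ordKV.
  by rewrite cast_ordK unsplitK.
(* By unfolding, [fam_cat] is [sum_family] composed with this bijection, so the goal matches up to
   conversion. *)
apply: (@absolutely_summing_reindex _ _ _ _ (sum_family X Z) Y _
  (sum_family q (fun=> 1)) bij_split).
by apply: absolutely_summing_sum; rewrite coincidence.
Qed.
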